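(* Let $\mathcal{C}$ be a regular Goursat category and let $\mathcal{X}$ be a (regular epi)-reflective subcategory of $\mathcal{C}$, with full inclusion $U\colon\mathcal{X}\to\mathcal{C}$ and reflector (left adjoint of $U$) $I\colon\mathcal{C}\to\mathcal{X}$. Then the reflector $I$ preserves pullbacks of pairs of split epimorphisms: for any split epimorphisms $f\colon X\to Y$ and $l\colon Z\to Y$ in $\mathcal{C}$, the functor $I$ sends the pullback of $f$ and $l$ in $\mathcal{C}$ to a pullback in $\mathcal{X}$.
   Context: A regular category $\mathcal{C}$ is called a Goursat category when $RSR=SRS$ for any two (effective) equivalence relations $R$ and $S$ on the same object of $\mathcal{C}$, where juxtaposition denotes the composition of relations and an equivalence relation is effective when it is the kernel pair of some morphism. A full reflective subcategory $\mathcal{X}$ of $\mathcal{C}$ is (regular epi)-reflective when each component $\eta_X\colon X\to UI(X)$ of the unit of the adjunction $I\dashv U$ is a regular epimorphism in $\mathcal{C}$. *)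

(* Defs.v *)
Set Implicit Arguments.
Unset Strict Implicit.
Unset Printing Implicit Defensive.

Declare Scope cat_scope.
Delimit Scope cat_scope with cat.

(** * Categories, functors, adjunctions *)

Record category := Category {
  Ob :> Type;
  Hom : Ob -> Ob -> Type;
  id : forall x, Hom x x;
  comp : forall x y z, Hom y z -> Hom x y -> Hom x z;
  comp_id_l : forall x y (f : Hom x y), comp (id y) f = f;
  comp_id_r : forall x y (f : Hom x y), comp f (id x) = f;
  comp_assoc : forall w x y z (h : Hom y z) (g : Hom x y) (f : Hom w x),
    comp h (comp g f) = comp (comp h g) f
}.

Arguments Hom {_} _ _.
Arguments id {_} _.
Arguments comp {_ _ _ _} _ _.

Notation "g ∘ f" := (comp g f) (at level 40, left associativity) : cat_scope.
Open Scope cat_scope.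

Record functor (C D : category) := Functor {
  fobj :> C -> D;
  fmap : forall x y : C, Hom x y -> Hom (fobj x) (fobj y);
  fmap_id : forall x : C, fmap (id x) = id (fobj x);
  fmap_comp : forall (x y z : C) (g : Hom y z) (f : Hom x y),
    fmap (g ∘ f) = fmap g ∘ fmap f
}.

Arguments fmap {_ _} _ {_ _} _.

(** [adjunction F G] is the data of an adjunction F ⊣ G. *)
Record adjunction (C D : category) (F : functor C D) (G : functor D C) :=
  Adjunction {
  unit : forall x : C, Hom x (G (F x));
  counit : forall a : D, Hom (F (G a)) a;
  unit_natural : forall (x y : C) (f : Hom x y),
    unit y ∘ f = fmap G (fmap F f) ∘ unit x;
  counit_natural : forall (a b : D) (g : Hom a b),
    counit b ∘ fmap F (fmap G g) = g ∘ counit a;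
  triangle_l : forall x : C, counit (F x) ∘ fmap F (unit x) = id (F x);
  triangle_r : forall a : D, fmap G (counit a) ∘ unit (G a) = id (G a)
}.

Definition full_subcategory (C : category) (X : C -> Prop) : category :=
  {| Ob := {x : C | X x};
     Hom := fun a b => Hom (proj1_sig a) (proj1_sig b);
     id := fun a => id (proj1_sig a);
     comp := fun a b c g f => comp g f;
     comp_id_l := fun a b f => comp_id_l f;
     comp_id_r := fun a b f => comp_id_r f;
     comp_assoc := fun a b c d h g f => comp_assoc h g f |}.

Definition inclusion (C : category) (X : C -> Prop) :
    functor (full_subcategory X) C :=
  {| fobj := fun a : full_subcategory X => proj1_sig a;
     fmap := fun (a b : full_subcategory X) (f : Hom a b) => f;
     fmap_id := fun a => eq_refl;
     fmap_comp := fun a b c g f => eq_refl |}.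

(** * Regular categories *)

Section Regular.
Variable C : category.

Definition mono (x y : C) (m : Hom x y) : Prop :=
  forall (t : C) (u v : Hom t x), m ∘ u = m ∘ v -> u = v.

Definition split_epi (x y : C) (f : Hom x y) : Prop :=
  exists s : Hom y x, f ∘ s = id y.

Definition is_terminal (t : C) : Prop :=
  forall x : C, exists! f : Hom x t, True.

(** The square with legs [p1 : p -> x], [p2 : p -> z] is a pullback of
    [f : x -> y] along [l : z -> y]. *)
Definition is_pullback (p x z y : C) (f : Hom x y) (l : Hom z y)
    (p1 : Hom p x) (p2 : Hom p z) : Prop :=
  f ∘ p1 = l ∘ p2 /\
  forall (t : C) (a : Hom t x) (b : Hom t z), f ∘ a = l ∘ b ->
    exists! h : Hom t p, p1 ∘ h = a /\ p2 ∘ h = b.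

Definition is_coequalizer (x y q : C) (a b : Hom x y) (e : Hom y q) : Prop :=
  e ∘ a = e ∘ b /\
  forall (t : C) (g : Hom y t), g ∘ a = g ∘ b ->
    exists! h : Hom q t, h ∘ e = g.

Definition regular_epi (x y : C) (e : Hom x y) : Prop :=
  exists (w : C) (a b : Hom w x), is_coequalizer a b e.

Definition finitely_complete : Prop :=
  (exists t : C, is_terminal t) /\
  forall (x y z : C) (f : Hom x y) (l : Hom z y),
    exists (p : C) (p1 : Hom p x) (p2 : Hom p z), is_pullback f l p1 p2.

Definition is_kernel_pair (k x y : C) (f : Hom x y) (k1 k2 : Hom k x) : Prop :=
  is_pullback f f k1 k2.

Record regular_category : Prop := RegularCategory {
  regular_complete : finitely_complete;
  regular_coequalizer : forall (k x y : C) (f : Hom x y) (k1 k2 : Hom k x),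
    is_kernel_pair f k1 k2 ->
    exists (q : C) (e : Hom x q), is_coequalizer k1 k2 e;
  regular_stable : forall (p x z y : C) (f : Hom x y) (l : Hom z y)
      (p1 : Hom p x) (p2 : Hom p z),
    is_pullback f l p1 p2 -> regular_epi f -> regular_epi p2
}.

(** * Relations *)

Record relation (x y : C) := Relation {
  rel_ob : C;
  rel1 : Hom rel_ob x;
  rel2 : Hom rel_ob y;
  rel_jointly_monic : forall (t : C) (u v : Hom t rel_ob),
    rel1 ∘ u = rel1 ∘ v -> rel2 ∘ u = rel2 ∘ v -> u = v
}.

Definition rel_le (x y : C) (R S : relation x y) : Prop :=
  exists h : Hom (rel_ob R) (rel_ob S),
    rel1 S ∘ h = rel1 R /\ rel2 S ∘ h = rel2 R.

(** Equality as subobjects of the product. *)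
Definition rel_eq (x y : C) (R S : relation x y) : Prop :=
  rel_le R S /\ rel_le S R.

(** [T] is the composite "first [R], then [S]": the (regular epi, mono) image
    in x × z of the pullback of [rel2 R] and [rel1 S].  Composites are
    determined up to [rel_eq], and exist in a regular category
    ([composite_exists] below). *)
Definition is_composite (x y z : C) (R : relation x y) (S : relation y z)
    (T : relation x z) : Prop :=
  exists (p : C) (p1 : Hom p (rel_ob R)) (p2 : Hom p (rel_ob S))
      (e : Hom p (rel_ob T)),
    is_pullback (rel2 R) (rel1 S) p1 p2 /\ regular_epi e /\
    rel1 T ∘ e = rel1 R ∘ p1 /\ rel2 T ∘ e = rel2 S ∘ p2.

Record is_equivalence (x : C) (R : relation x x) : Prop := IsEquivalence {
  equivalence_refl : exists d : Hom x (rel_ob R),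
    rel1 R ∘ d = id x /\ rel2 R ∘ d = id x;
  equivalence_sym : exists s : Hom (rel_ob R) (rel_ob R),
    rel1 R ∘ s = rel2 R /\ rel2 R ∘ s = rel1 R;
  equivalence_trans : forall (p : C) (p1 p2 : Hom p (rel_ob R)),
    is_pullback (rel2 R) (rel1 R) p1 p2 ->
    exists t : Hom p (rel_ob R),
      rel1 R ∘ t = rel1 R ∘ p1 /\ rel2 R ∘ t = rel2 R ∘ p2
}.

Definition is_effective_equivalence (x : C) (R : relation x x) : Prop :=
  is_equivalence R /\
  exists (y : C) (f : Hom x y), is_kernel_pair f (rel1 R) (rel2 R).

Definition goursat_category : Prop :=
  regular_category /\
  forall (x : C) (R S : relation x x),
    is_effective_equivalence R -> is_effective_equivalence S ->
    forall RS RSR SR SRS : relation x x,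
      is_composite R S RS -> is_composite RS R RSR ->
      is_composite S R SR -> is_composite SR S SRS ->
      rel_eq RSR SRS.

(** * Existence of composites *)

Lemma regular_epi_cancel (x y : C) (e : Hom x y) : regular_epi e ->
  forall (t : C) (u v : Hom y t), u ∘ e = v ∘ e -> u = v.
Proof.
intros [w [a [b [E U]]]] t u v H.
destruct (U t (u ∘ e)) as [h [_ Hu]].
- now rewrite <- !comp_assoc, E.
- now rewrite <- (Hu u eq_refl), <- (Hu v (eq_sym H)).
Qed.

Lemma image_factorization (x y : C) (f : Hom x y) : regular_category ->
  exists (i : C) (e : Hom x i) (m : Hom i y),
    regular_epi e /\ mono m /\ m ∘ e = f.
Proof.
intros [[_ PB] CQ ST].
destruct (PB _ _ _ f f) as [k [k1 [k2 K]]].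
destruct (CQ _ _ _ _ _ _ K) as [i [e E]].
destruct (proj2 E y f (proj1 K)) as [m [Hm _]].
assert (Re : regular_epi e) by (exists k, k1, k2; exact E).
exists i, e, m; split; [exact Re | split; [| exact Hm]].
intros t u v Huv.
destruct (PB _ _ _ e u) as [a [a1 [a2 A]]].
destruct (PB _ _ _ e v) as [b [b1 [b2 B]]].
destruct (PB _ _ _ a2 b2) as [w [w1 [w2 W]]].
pose proof (ST _ _ _ _ _ _ _ _ A Re) as Ra.
pose proof (ST _ _ _ _ _ _ _ _ B Re) as Rb.
pose proof (ST _ _ _ _ _ _ _ _ W Ra) as Rw.
apply (regular_epi_cancel Rb), (regular_epi_cancel Rw).
destruct A as [A _], B as [B _], W as [W _].
assert (H : f ∘ (a1 ∘ w1) = f ∘ (b1 ∘ w2)).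
{ rewrite <- Hm, <- !comp_assoc, (comp_assoc e a1), (comp_assoc e b1), A, B.
  rewrite <- !comp_assoc, W, !comp_assoc, Huv; reflexivity. }
destruct (proj2 K _ _ _ H) as [h [[H1 H2] _]].
rewrite <- B, <- !comp_assoc, <- W, comp_assoc, <- A, <- comp_assoc, <- H1, <- H2.
rewrite !comp_assoc, (proj1 E); reflexivity.
Qed.

Lemma composite_exists (x y z : C) (R : relation x y) (S : relation y z) :
  regular_category -> exists T : relation x z, is_composite R S T.
Proof.
intros HC; destruct (regular_complete HC) as [[o O] PB].
destruct (PB _ _ _ (rel2 R) (rel1 S)) as [p [p1 [p2 P]]].
destruct (O x) as [ox [_ _]], (O z) as [oz [_ _]].
destruct (PB _ _ _ ox oz) as [c [c1 [c2 [_ U]]]].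
assert (O2 : forall t (u v : Hom t o), u = v).
{ intros t u v; destruct (O t) as [w [_ Hw]].
  now rewrite <- (Hw u I), <- (Hw v I). }
destruct (U p (rel1 R ∘ p1) (rel2 S ∘ p2) (O2 _ _ _)) as [h [[H1 H2] _]].
destruct (image_factorization h HC) as [i [e [m [Re [Mm Hm]]]]].
assert (J : forall t (u v : Hom t i),
  c1 ∘ m ∘ u = c1 ∘ m ∘ v -> c2 ∘ m ∘ u = c2 ∘ m ∘ v -> u = v).
{ intros t u v E1 E2; apply Mm.
  rewrite <- !comp_assoc in E1, E2.
  destruct (U t _ _ (O2 _ (ox ∘ (c1 ∘ (m ∘ v))) (oz ∘ (c2 ∘ (m ∘ v)))))
    as [g [_ Hg]].
  rewrite <- (Hg (m ∘ v) (conj eq_refl eq_refl)).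
  now rewrite <- (Hg (m ∘ u) (conj E1 E2)). }
exists (Relation J), p, p1, p2, e; simpl.
rewrite <- !comp_assoc, Hm; auto.
Qed.

End Regular.

Definition regular_epi_reflective (C : category) (X : C -> Prop)
    (I : functor C (full_subcategory X)) (adj : adjunction I (inclusion X)) :
    Prop :=
  forall x : C, regular_epi (unit adj x).

(* Main.v *)
Require Import Defs.

Set Implicit Arguments.
Unset Strict Implicit.

(** Generalized elements [t -> x] are used as if they were points, and
    regular epimorphisms [t' -> t] as changes of stage; in a regular category
    the image of a morphism consists of the points that lift after such a
    change.  Write [u ~ v] when [eta ∘ u = eta ∘ v], where [eta] is the unit.
    By naturality every morphism preserves [~].

    The Goursat axiom enters only through [goursat_zigzag]: if
    [g a = g b], [h b = h c] and [g c = g d], then locally there are [m], [n]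
    with [h a = h m], [g m = g n], [h n = h d].  Let [s], [r] be sections of
    [f], [l], and write the points of the pullback [p] as pairs.

    Existence.  A compatible pair of points of the reflections of [x] and [z]
    lifts locally to [x0], [z0] with [y0 := f x0 ~ l z0 =: y1].  In [p],
    the points (x0, r y0), (s y0, r y0), (s y1, r y1), (s y1, z0) form a zigzag
    for the projection to [y] and for [~].  Reversing it gives points m, n of
    [p] over the same point of [y] with m ~ (x0, r y0) and n ~ (s y1, z0);
    the pair made of the first coordinate of m and the second one of n is the
    point of [p] sought ([quotient_comparison_lifts]).

    Uniqueness.  Suppose two points of [p] have [~]-related coordinates.  A
    first zigzag, through the points (x, r (f x)), replaces them up to [~] by
    points with the same first coordinate.  The shifting argument for modular
    congruence lattices then applies to the kernel pairs of the projections,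
    whose intersection is trivial, and shows that the points are [~]-related
    ([quotient_comparison_monic]).

    Points of the reflection of [p] found locally agree on overlaps by
    uniqueness, so they descend along regular epimorphisms. *)

(** * Regular epimorphisms *)

Section Regular.
Context {C : category}.

Lemma comp_eq_assoc (w v v' x y : C) (g : Hom v y) (f : Hom x v)
    (g' : Hom v' y) (f' : Hom x v') (h : Hom w x) :
  g ∘ f = g' ∘ f' -> g ∘ (f ∘ h) = g' ∘ (f' ∘ h).
Proof. intros E; now rewrite !comp_assoc, E. Qed.

(** A regular epimorphism is strong, so the monic part of the image
    factorization of a composite of two of them is invertible; the composite
    is then a coequalizer along with its image part. *)
Lemma regular_epi_comp (HC : regular_category C) (x y z : C)
    (e : Hom x y) (e' : Hom y z) :
  regular_epi e -> regular_epi e' -> regular_epi (e' ∘ e).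
Proof.
intros Re Re'.
destruct (image_factorization (e' ∘ e) HC) as [i [q [m [Rq [Mm Hm]]]]].
assert (exists k : Hom y i, m ∘ k = e') as [k Hk].
{ destruct Re as [w [a [b [E U]]]].
  destruct (U _ q) as [k [Hk _]].
  - apply Mm; now rewrite !comp_assoc, Hm, <- !comp_assoc, E.
  - exists k; apply (regular_epi_cancel (e := e)); [exists w, a, b; now split|].
    now rewrite <- comp_assoc, Hk. }
assert (exists j : Hom z i, m ∘ j = id z) as [j Hj].
{ pose proof Re' as [w [a [b [E U]]]].
  destruct (U _ k) as [j [Hj _]].
  - apply Mm; now rewrite !comp_assoc, Hk, E.
  - exists j; apply (regular_epi_cancel Re').
    now rewrite <- comp_assoc, Hj, Hk, comp_id_l. }
assert (Hj' : j ∘ m = id i).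
{ apply Mm; now rewrite comp_assoc, Hj, comp_id_l, comp_id_r. }
destruct Rq as [w [a [b [E U]]]].
exists w, a, b; split.
- now rewrite <- Hm, <- !comp_assoc, E.
- intros t g Hg; destruct (U t g Hg) as [h [Hh Uh]].
  exists (h ∘ j); split.
  + now rewrite <- Hm, <- comp_assoc, (comp_assoc j), Hj', comp_id_l.
  + intros h' Hh'; rewrite (Uh (h' ∘ m)).
    * now rewrite <- comp_assoc, Hj, comp_id_r.
    * now rewrite <- comp_assoc, Hm.
Qed.

Lemma lift_regular_epi (HC : regular_category C) (x q t : C) (e : Hom x q)
    (a : Hom t q) : regular_epi e ->
  exists (t' : C) (c : Hom t' t) (a' : Hom t' x),
    regular_epi c /\ e ∘ a' = a ∘ c.
Proof.
intros Re; destruct HC as [[_ PB] _ ST].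
destruct (PB _ _ _ e a) as [t' [a' [c P]]].
exists t', c, a'; split; [exact (ST _ _ _ _ _ _ _ _ P Re) | exact (proj1 P)].
Qed.

(** Descent: a point found on a cover satisfies the gluing condition because
    it is determined by its images under the jointly monic [m1], [m2]. *)
Lemma descend_jointly_monic (q x z t t' : C) (m1 : Hom q x) (m2 : Hom q z)
    (e : Hom t' t) (a : Hom t x) (b : Hom t z) (h' : Hom t' q) :
  (forall (w : C) (u v : Hom w q), m1 ∘ u = m1 ∘ v -> m2 ∘ u = m2 ∘ v -> u = v) ->
  regular_epi e -> m1 ∘ h' = a ∘ e -> m2 ∘ h' = b ∘ e ->
  exists h : Hom t q, m1 ∘ h = a /\ m2 ∘ h = b.
Proof.
intros J Re H1 H2; pose proof Re as [w [c [d [E U]]]].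
destruct (U _ h') as [h [Hh _]].
- apply J.
  + now rewrite !comp_assoc, H1, <- !comp_assoc, E.
  + now rewrite !comp_assoc, H2, <- !comp_assoc, E.
- exists h; split; apply (regular_epi_cancel Re); now rewrite <- comp_assoc, Hh.
Qed.

(** The morphism to the product with components [g] and [h], seen through its
    kernel pair. *)
Lemma intersect_kernels (HC : finitely_complete C) (x y z : C)
    (g : Hom x y) (h : Hom x z) :
  exists (q : C) (k : Hom x q), forall (t : C) (u v : Hom t x),
    k ∘ u = k ∘ v <-> g ∘ u = g ∘ v /\ h ∘ u = h ∘ v.
Proof.
destruct HC as [[o O] PB].
assert (O2 : forall t (u v : Hom t o), u = v).
{ intros t u v; destruct (O t) as [w [_ Hw]].
  now rewrite <- (Hw u I), <- (Hw v I). }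
destruct (O y) as [oy _], (O z) as [oz _].
destruct (PB _ _ _ oy oz) as [c [c1 [c2 [_ U]]]].
destruct (U x g h (O2 _ _ _)) as [k [[H1 H2] _]].
exists c, k; intros t u v; split.
- intros E; split.
  + now rewrite <- H1, <- !comp_assoc, E.
  + now rewrite <- H2, <- !comp_assoc, E.
- intros [E1 E2].
  destruct (U t (g ∘ u) (h ∘ u) (O2 _ _ _)) as [w [_ Hw]].
  rewrite <- (Hw (k ∘ u)), <- (Hw (k ∘ v)); auto;
    rewrite !comp_assoc, H1, H2; auto.
Qed.

(** * The Goursat axiom on generalized elements *)

Definition related (x y t : C) (R : relation x y) (u : Hom t x) (v : Hom t y) :
    Prop :=
  exists w : Hom t (rel_ob R), rel1 R ∘ w = u /\ rel2 R ∘ w = v.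

Lemma related_composite (x y z : C) (R : relation x y) (S : relation y z)
    (T : relation x z) (t : C) (u : Hom t x) (v : Hom t y) (w : Hom t z) :
  is_composite R S T -> related R u v -> related S v w -> related T u w.
Proof.
intros [p [p1 [p2 [e [P [_ [E1 E2]]]]]]] [r [R1 R2]] [k [S1 S2]].
destruct (proj2 P t r k) as [h [[H1 H2] _]]; [now rewrite R2, S1|].
exists (e ∘ h); rewrite !comp_assoc, E1, E2, <- !comp_assoc, H1, H2; auto.
Qed.

(** A composite is an image, so the intermediate point exists only after a
    change of stage. *)
Lemma related_composite_inv (HC : regular_category C) (x y z : C)
    (R : relation x y) (S : relation y z) (T : relation x z)
    (t : C) (u : Hom t x) (w : Hom t z) :
  is_composite R S T -> related T u w ->
  exists (t' : C) (e : Hom t' t) (v : Hom t' y),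
    regular_epi e /\ related R (u ∘ e) v /\ related S v (w ∘ e).
Proof.
intros [p [p1 [p2 [q [P [Rq [E1 E2]]]]]]] [k [K1 K2]].
destruct (lift_regular_epi HC k Rq) as [t' [e [k' [Re He]]]].
exists t', e, (rel2 R ∘ (p1 ∘ k')); split; [exact Re|]; split.
- exists (p1 ∘ k'); split; [|reflexivity].
  now rewrite comp_assoc, <- E1, <- comp_assoc, He, comp_assoc, K1.
- exists (p2 ∘ k'); split.
  + symmetry; apply comp_eq_assoc, P.
  + now rewrite comp_assoc, <- E2, <- comp_assoc, He, comp_assoc, K2.
Qed.

Lemma related_precomp (x y t t' : C) (R : relation x y) (u : Hom t x)
    (v : Hom t y) (e : Hom t' t) :
  related R u v -> related R (u ∘ e) (v ∘ e).
Proof.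
intros [w [E1 E2]]; exists (w ∘ e).
now rewrite !comp_assoc, E1, E2.
Qed.

Lemma kernel_relation (HC : finitely_complete C) (x y : C) (g : Hom x y) :
  exists R : relation x x, is_effective_equivalence R /\
    forall (t : C) (u v : Hom t x), related R u v <-> g ∘ u = g ∘ v.
Proof.
destruct HC as [_ PB].
destruct (PB _ _ _ g g) as [k [k1 [k2 K]]].
assert (J : forall t (u v : Hom t k),
  k1 ∘ u = k1 ∘ v -> k2 ∘ u = k2 ∘ v -> u = v).
{ intros t u v E1 E2.
  destruct (proj2 K t (k1 ∘ u) (k2 ∘ u)) as [w [_ Hw]].
  - apply comp_eq_assoc, K.
  - now rewrite <- (Hw u), <- (Hw v). }
assert (HR : forall t (u v : Hom t x),
  related (Relation J) u v <-> g ∘ u = g ∘ v).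
{ intros t u v; split.
  - intros [w [<- <-]]; apply comp_eq_assoc, K.
  - intros E; destruct (proj2 K t u v E) as [w [Hw _]]; now exists w. }
exists (Relation J); split; [|exact HR].
split; [|now exists y, g].
split.
- now apply (proj2 (HR _ (id x) (id x))).
- apply (proj2 (HR k k2 k1)); symmetry; apply K.
- intros p p1 p2 [P _]; apply (proj2 (HR p (k1 ∘ p1) (k2 ∘ p2))).
  simpl in *.
  rewrite (comp_eq_assoc p1 (proj1 K)), P.
  apply comp_eq_assoc, K.
Qed.

(** The inclusion [RSR <= SRS] for the kernel pairs [R] of [g] and [S] of
    [h]; [m] and [n] witness the two composites, hence live on a cover. *)
Lemma goursat_zigzag (HC : goursat_category C) (x y z : C)
    (g : Hom x y) (h : Hom x z) (t : C) (a b c d : Hom t x) :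
  g ∘ a = g ∘ b -> h ∘ b = h ∘ c -> g ∘ c = g ∘ d ->
  exists (t' : C) (e : Hom t' t) (m n : Hom t' x),
    regular_epi e /\ h ∘ (a ∘ e) = h ∘ m /\ g ∘ m = g ∘ n /\
    h ∘ n = h ∘ (d ∘ e).
Proof.
intros Eab Ebc Ecd; destruct HC as [HC G].
destruct (kernel_relation (regular_complete HC) g) as [R [ER HR]].
destruct (kernel_relation (regular_complete HC) h) as [S [ES HS]].
destruct (composite_exists R S HC) as [RS CRS].
destruct (composite_exists RS R HC) as [RSR CRSR].
destruct (composite_exists S R HC) as [SR CSR].
destruct (composite_exists SR S HC) as [SRS CSRS].
destruct (G x R S ER ES _ _ _ _ CRS CRSR CSR CSRS) as [[k [K1 K2]] _].
assert (H : related SRS a d).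
{ assert (related RSR a d) as [w [<- <-]].
  { apply (related_composite (v := c) CRSR); [|now apply HR].
    apply (related_composite (v := b) CRS); [now apply HR | now apply HS]. }
  exists (k ∘ w); now rewrite !comp_assoc, K1, K2. }
destruct (related_composite_inv HC CSRS H) as [t1 [e1 [n [Re1 [H1 H2]]]]].
destruct (related_composite_inv HC CSR H1) as [t2 [e2 [m [Re2 [H3 H4]]]]].
exists t2, (e1 ∘ e2), m, (n ∘ e2).
split; [now apply regular_epi_comp|].
split; [|split].
- rewrite (comp_assoc a); now apply HS.
- now apply HR.
- rewrite (comp_assoc d); now apply HS, related_precomp.
Qed.

(** * Quotients of the identity functor and pullbacks of split epimorphisms *)

Section Quotient.
Variables (HC : goursat_category C) (F : functor C C).
Variable eta : forall x : C, Hom x (F x).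
Hypothesis eta_natural : forall (x y : C) (f : Hom x y),
  eta y ∘ f = fmap F f ∘ eta x.
Hypothesis eta_regular_epi : forall x : C, regular_epi (eta x).

Lemma eta_congruence (x y t : C) (k : Hom x y) (u v : Hom t x) :
  eta x ∘ u = eta x ∘ v -> eta y ∘ (k ∘ u) = eta y ∘ (k ∘ v).
Proof. intros E; now rewrite !comp_assoc, eta_natural, <- !comp_assoc, E. Qed.

Variables (x y z p : C) (f : Hom x y) (l : Hom z y).
Variables (p1 : Hom p x) (p2 : Hom p z).
Hypotheses (hf : split_epi f) (hl : split_epi l) (hp : is_pullback f l p1 p2).

Lemma pullback_sections : exists (s : Hom y x) (r : Hom y z)
    (i : Hom x p) (j : Hom z p),
  (f ∘ s = id y /\ l ∘ r = id y) /\
  (p1 ∘ i = id x /\ p2 ∘ i = r ∘ f) /\ (p1 ∘ j = s ∘ l /\ p2 ∘ j = id z).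
Proof.
destruct hf as [s Hs], hl as [r Hr].
destruct (proj2 hp x (id x) (r ∘ f)) as [i [Hi _]].
{ now rewrite comp_assoc, Hr, comp_id_l, comp_id_r. }
destruct (proj2 hp z (s ∘ l) (id z)) as [j [Hj _]].
{ now rewrite comp_assoc, Hs, comp_id_l, comp_id_r. }
now exists s, r, i, j.
Qed.

Lemma pullback_jointly_monic (t : C) (u v : Hom t p) :
  p1 ∘ u = p1 ∘ v -> p2 ∘ u = p2 ∘ v -> u = v.
Proof.
intros E1 E2; destruct (proj2 hp t (p1 ∘ u) (p2 ∘ u)) as [w [_ Hw]].
- apply comp_eq_assoc, hp.
- now rewrite <- (Hw u), <- (Hw v).
Qed.

(** Shifting argument: [d1] and [d2], which share their first coordinate [x0],
    are linked by a zigzag through the points with coordinates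
    [s (f x0)], [p2 d1] and [s (f x0)], [p2 d2], which are identified by [eta]
    and by [p1].  In the reversed zigzag the middle step lies in both kernel
    pairs, hence is an equality. *)
Lemma eta_separates_in_fibre (t : C) (d1 d2 : Hom t p) :
  p1 ∘ d1 = p1 ∘ d2 -> eta z ∘ (p2 ∘ d1) = eta z ∘ (p2 ∘ d2) ->
  eta p ∘ d1 = eta p ∘ d2.
Proof.
intros E1 E2.
destruct pullback_sections as [s [r [i [j [_ [_ [Hj1 Hj2]]]]]]].
destruct (intersect_kernels (regular_complete (proj1 HC)) (eta p) p1)
  as [q [k Hk]].
destruct (@goursat_zigzag HC _ _ _ p2 k t d1 (j ∘ (p2 ∘ d1)) (j ∘ (p2 ∘ d2)) d2)
  as [t' [e [m [n [Re [Ha [Hmn Hd]]]]]]].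
- now rewrite (comp_assoc p2 j), Hj2, comp_id_l.
- apply Hk; split; [now apply eta_congruence|].
  rewrite !(comp_assoc p1 j), Hj1, <- !comp_assoc.
  now rewrite <- !(comp_eq_assoc _ (proj1 hp)), E1.
- now rewrite (comp_assoc p2 j), Hj2, comp_id_l.
- apply Hk in Ha, Hd; destruct Ha as [Ha1 Ha2], Hd as [Hd1 Hd2].
  assert (m = n) as <-.
  { apply pullback_jointly_monic; [|exact Hmn].
    now rewrite <- Ha2, Hd2, !comp_assoc, E1. }
  apply (regular_epi_cancel Re); rewrite <- !comp_assoc.
  now rewrite Ha1.
Qed.

Lemma eta_separates_pullback (t : C) (d1 d2 : Hom t p) :
  eta x ∘ (p1 ∘ d1) = eta x ∘ (p1 ∘ d2) ->
  eta z ∘ (p2 ∘ d1) = eta z ∘ (p2 ∘ d2) -> eta p ∘ d1 = eta p ∘ d2.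
Proof.
intros E1 E2.
destruct pullback_sections as [s [r [i [j [_ [[Hi1 Hi2] _]]]]]].
destruct (@goursat_zigzag HC _ _ _ p1 (eta p) t
    d1 (i ∘ (p1 ∘ d1)) (i ∘ (p1 ∘ d2)) d2)
  as [t' [e [m [n [Re [Hm [Hmn Hn]]]]]]].
- now rewrite (comp_assoc p1 i), Hi1, comp_id_l.
- now apply eta_congruence.
- now rewrite (comp_assoc p1 i), Hi1, comp_id_l.
- apply (regular_epi_cancel Re); rewrite <- !comp_assoc, Hm, <- Hn.
  apply eta_separates_in_fibre; [exact Hmn|].
  rewrite <- (eta_congruence p2 Hm), (eta_congruence p2 Hn).
  now rewrite !comp_assoc in *; rewrite E2.
Qed.

Lemma quotient_comparison_monic (t : C) (u v : Hom t (F p)) :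
  fmap F p1 ∘ u = fmap F p1 ∘ v -> fmap F p2 ∘ u = fmap F p2 ∘ v -> u = v.
Proof.
intros E1 E2; pose proof (proj1 HC) as HR.
destruct (lift_regular_epi HR u (eta_regular_epi p)) as [t1 [e1 [a [Re1 Ha]]]].
destruct (lift_regular_epi HR (v ∘ e1) (eta_regular_epi p))
  as [t2 [e2 [b [Re2 Hb]]]].
apply (regular_epi_cancel Re1), (regular_epi_cancel Re2).
rewrite <- Hb, <- Ha, <- comp_assoc.
apply eta_separates_pullback.
- rewrite !(comp_eq_assoc _ (eta_natural p1)), Hb, (comp_eq_assoc _ Ha).
  now rewrite !comp_assoc, E1.
- rewrite !(comp_eq_assoc _ (eta_natural p2)), Hb, (comp_eq_assoc _ Ha).
  now rewrite !comp_assoc, E2.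
Qed.

Lemma quotient_comparison_lifts (t : C) (a : Hom t (F x)) (b : Hom t (F z)) :
  fmap F f ∘ a = fmap F l ∘ b ->
  exists (t' : C) (e : Hom t' t) (h : Hom t' p),
    regular_epi e /\ eta x ∘ (p1 ∘ h) = a ∘ e /\ eta z ∘ (p2 ∘ h) = b ∘ e.
Proof.
intros E; pose proof (proj1 HC) as HR.
destruct (lift_regular_epi HR a (eta_regular_epi x)) as [t1 [e1 [a1 [Re1 Ha]]]].
destruct (lift_regular_epi HR (b ∘ e1) (eta_regular_epi z))
  as [t2 [e2 [z0 [Re2 Hb]]]].
set (x0 := a1 ∘ e2).
assert (Hx0 : eta x ∘ x0 = a ∘ (e1 ∘ e2)).
{ unfold x0; now rewrite (comp_eq_assoc _ Ha). }
rewrite <- comp_assoc in Hb.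
destruct pullback_sections as [s [r [i [j [[Hs Hr] [[Hi1 Hi2] [Hj1 Hj2]]]]]]].
assert (Hfi : f ∘ p1 ∘ i = f) by now rewrite <- comp_assoc, Hi1, comp_id_r.
assert (Hfj : f ∘ p1 ∘ j = l).
{ now rewrite (proj1 hp), <- comp_assoc, Hj2, comp_id_r. }
(* With y0 = f x0 and y1 = l z0, the zigzag consists of
   (x0, r y0), (s y0, r y0), (s y1, r y1), (s y1, z0). *)
destruct (@goursat_zigzag HC _ _ _ (f ∘ p1) (eta p) t2
    (i ∘ x0) (i ∘ s ∘ (f ∘ x0)) (i ∘ s ∘ (l ∘ z0)) (j ∘ z0))
  as [t3 [e3 [m [n [Re3 [Hm [Hmn Hn]]]]]]].
- rewrite !(comp_assoc (f ∘ p1)), Hfi, Hs; now rewrite comp_id_l.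
- apply eta_congruence.
  rewrite !(comp_eq_assoc _ (eta_natural _)), Hx0, Hb.
  now rewrite (comp_assoc _ a), E, <- comp_assoc.
- rewrite !(comp_assoc (f ∘ p1)), Hfj, Hfi, Hs; now rewrite comp_id_l.
- destruct (proj2 hp t3 (p1 ∘ m) (p2 ∘ n)) as [h [[H1 H2] _]].
  { rewrite !comp_assoc, <- (proj1 hp); exact Hmn. }
  exists t3, (e1 ∘ e2 ∘ e3), h; split; [|split].
  + repeat apply regular_epi_comp; auto.
  + rewrite H1, <- (eta_congruence p1 Hm), (comp_assoc a), <- Hx0.
    now rewrite !comp_assoc, <- (comp_assoc _ p1 i), Hi1, comp_id_r.
  + rewrite H2, (eta_congruence p2 Hn), (comp_assoc b), <- Hb.
    now rewrite !comp_assoc, <- (comp_assoc _ p2 j), Hj2, comp_id_r.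
Qed.

(** Stated for an endofunctor so that both squares lie in the same category;
    a reflector followed by the inclusion of its subcategory is such an [F]. *)
Lemma quotient_preserves_split_pullback :
  is_pullback (fmap F f) (fmap F l) (fmap F p1) (fmap F p2).
Proof.
split; [now rewrite <- !fmap_comp, (proj1 hp)|].
intros t a b E.
destruct (quotient_comparison_lifts E) as [t' [e [h' [Re [H1 H2]]]]].
destruct (descend_jointly_monic (m1 := fmap F p1) (m2 := fmap F p2)
    (a := a) (b := b) (h' := eta p ∘ h') quotient_comparison_monic Re)
  as [h [Ha Hb]].
- now rewrite <- (comp_eq_assoc _ (eta_natural p1)).
- now rewrite <- (comp_eq_assoc _ (eta_natural p2)).
- exists h; split; [now split|].
  intros h2 [Ha2 Hb2]; apply quotient_comparison_monic; congruence.
Qed.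

End Quotient.
End Regular.

Definition functor_comp (C D E : category) (G : functor D E) (F : functor C D) :
    functor C E :=
  {| fobj := fun x => G (F x);
     fmap := fun x y f => fmap G (fmap F f);
     fmap_id := fun x => eq_trans (f_equal (fmap G) (fmap_id F x)) (fmap_id G (F x));
     fmap_comp := fun x y z g f =>
       eq_trans (f_equal (fmap G) (fmap_comp F g f))
         (fmap_comp G (fmap F g) (fmap F f)) |}.

Theorem proposition2p1 (C : category) (HC : goursat_category C)
    (X : C -> Prop) (I : functor C (full_subcategory X))
    (adj : adjunction I (inclusion X)) (HX : regular_epi_reflective adj)
    (x y z : C) (f : Hom x y) (l : Hom z y)
    (hf : split_epi f) (hl : split_epi l)
    (p : C) (p1 : Hom p x) (p2 : Hom p z) (hp : is_pullback f l p1 p2) :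
  is_pullback (fmap I f) (fmap I l) (fmap I p1) (fmap I p2).
Proof.
pose proof (@quotient_preserves_split_pullback C HC
  (functor_comp (inclusion X) I) (unit adj) (fun x y f => unit_natural adj f)
  HX _ _ _ _ _ _ _ _ hf hl hp) as [E U].
(* A full subcategory reflects limits. *)
split; [exact E|].
intros t a b; exact (U (proj1_sig t) a b).
Qed.
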